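(* Consider the problem $$\text{minimize}_{\gamma}\ \ \frac{a_k}{2}\|\gamma-u^k\|_2^2\quad\text{subject to}\quad \gamma\in\{0,1\}^m,\ \ \mathbf 1^T\gamma=m-K .$$ Let $[u^k]_K$ be the $K$th smallest element of $u^k$. The $i$th element of the solution to this problem is given by $$\gamma_i=\begin{cases}1 & \text{if } u_i^k\ge [u^k]_K,\\ 0 & \text{otherwise},\end{cases}$$ for $i=1,\dots,m$.
   Context: Here $m$ is the number of transmission lines of a power network with $n$ buses, $K$ is the prescribed number of lines taken out of service, $\gamma\in\{0,1\}^m$ indicates which lines are in service ($\gamma_l=1$) or out of service ($\gamma_l=0$), and $\mathbf 1$ is the all-ones vector. The index $k$ is the iteration index of a proximal alternating linearization method, $a_k>0$ is a positive coefficient, and $u^k\in\mathbb{R}^m$ is the vector (fixed in this problem) $u^k=\gamma^k-\frac{1}{a_k}\nabla_\gamma H_\rho(\gamma^k,z^k,\theta^k)$, where $(\gamma^k,z^k,\theta^k)\in\mathbb{R}^m\times\mathbb{R}^n\times\mathbb{R}^n$ is the current iterate and $H_\rho(\gamma,z,\theta)=-\mathbf 1^Tz_d+\frac{\rho}{2}\|ED\,\mathrm{diag}(\gamma)\sin(E^T\theta)-(P+z)\|_2^2$. In $H_\rho$, $\rho>0$ is a penalty coefficient, $E\in\mathbb{R}^{n\times m}$ is the incidence matrix of the network, $D\in\mathbb{R}^{m\times m}$ is the diagonal matrix of line admittances, $P\in\mathbb{R}^n$ is the vector of real power injections, $z=[z_d^T\ z_g^T]^T\in\mathbb{R}^n$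 collects the load-shedding vector $z_d$ and the generation-reduction vector $z_g$, $\theta\in\mathbb{R}^n$ is the vector of phase angles, and the sine acts elementwise.
   Formalization: As printed the formula gives an infeasible γ. Here 1≤K≤m; the formula is proved with the (K+1)th smallest element as threshold when K<m and it exceeds the Kth; in general, solutions are the feasible γ that obey the printed formula wherever u_i differs from the Kth smallest. *)

(* Defs.v *)
From HB Require Import structures.
From mathcomp Require Import all_boot all_order all_algebra.
From mathcomp Require Import all_classical all_reals all_analysis.
Set Implicit Arguments.
Unset Strict Implicit.
Unset Printing Implicit Defensive.
Import Order.TTheory GRing.Theory Num.Theory.
Import numFieldNormedType.Exports.
Local Open Scope ring_scope.

(* Squared Euclidean norm; the library norm `|v| on matrices is the sup norm. *)
Definition sqnorm2 (R : realType) (m : nat) (v : 'cV[R]_m) : R :=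
  \sum_(i < m) v i 0 ^+ 2.

(* Line l is oriented from bus src l to bus dst l. *)
Definition incidence (R : realType) (n m : nat) (src dst : 'I_m -> 'I_n) :
    'M[R]_(n, m) :=
  \matrix_(i, l) ((i == src l)%:R - (i == dst l)%:R).

(* The buses are ordered with the nd load buses first, so that
   z = col_mx z_d z_g and z_d = usubmx z. *)
Definition Hrho (R : realType) (nd ng m : nat) (src dst : 'I_m -> 'I_(nd + ng))
    (d : 'cV[R]_m) (P : 'cV[R]_(nd + ng)) (rho : R)
    (gam : 'cV[R]_m) (z theta : 'cV[R]_(nd + ng)) : R :=
  let E := incidence R src dst in
  - (\sum_(i < nd) usubmx z i 0)
  + rho / 2 * sqnorm2 (E *m diag_mx d^T *m diag_mx gam^T
                         *m map_mx (@sin R) (E^T *m theta) - (P + z)).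

Definition grad (R : realType) (m : nat) (f : 'cV[R]_m -> R) (x : 'cV[R]_m) :
    'cV[R]_m :=
  \col_i 'D_(delta_mx i 0) f x.

Definition prox_point (R : realType) (nd ng m : nat)
    (src dst : 'I_m -> 'I_(nd + ng)) (d : 'cV[R]_m) (P : 'cV[R]_(nd + ng))
    (rho a : R) (gam : 'cV[R]_m) (z theta : 'cV[R]_(nd + ng)) : 'cV[R]_m :=
  gam - a^-1 *: grad (fun g => Hrho src dst d P rho g z theta) gam.

Definition feasible (R : realType) (m K : nat) (gam : 'cV[R]_m) : Prop :=
  (forall i, gam i 0 = 0 \/ gam i 0 = 1)
  /\ \sum_(i < m) gam i 0 = m%:R - K%:R.

Definition is_solution (R : realType) (m K : nat) (a : R) (u gam : 'cV[R]_m) :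
    Prop :=
  feasible K gam
  /\ forall gam' : 'cV[R]_m, feasible K gam' ->
       a / 2 * sqnorm2 (gam - u) <= a / 2 * sqnorm2 (gam' - u).

(* Entries are counted with multiplicity and from 1: kth_smallest u 1 is the
   minimum and kth_smallest u m the maximum; meaningful for 1 <= k <= m only. *)
Definition kth_smallest (R : realType) (m : nat) (u : 'cV[R]_m) (k : nat) : R :=
  nth 0 (sort <=%R [seq u i 0 | i <- enum 'I_m]) k.-1.

Definition threshold (R : realType) (m : nat) (u : 'cV[R]_m) (t : R) (i : 'I_m) :
    R :=
  if t <= u i 0 then 1 else 0.

(* Main.v *)
Require Import Defs.
From HB Require Import structures.
From mathcomp Require Import all_boot all_order all_algebra.
From mathcomp Require Import all_classical all_reals all_analysis.
From mathcomp Require Import ring lra.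
Import Order.TTheory GRing.Theory Num.Theory.
Import numFieldNormedType.Exports.
Local Open Scope ring_scope.
Set Implicit Arguments.
Unset Strict Implicit.

(** Every 0/1 vector satisfies gam_i ^ 2 = gam_i, so on the feasible set the
    objective is affine in gam. All feasible points have the same coordinate sum,
    which makes the gap between two of them insensitive to a common shift of u:
    for every real t,
      |gam' - u|^2 - |gam - u|^2 = 2 * \sum_i (gam_i - gam'_i) * (u_i - t)
    ([feasible_cost_gap]). The shift t is the Lagrange multiplier of the
    cardinality constraint. If gam follows the threshold rule at level t wherever
    u_i <> t, each summand is nonnegative, and it vanishes only if u_i = t or
    gam'_i = gam_i. Hence, as soon as one feasible point obeys the rule at level
    t, the solutions are exactly the feasible points obeying it
    ([is_solution_cutP]).

    Such a point comes from sorting the indices by their entries and switching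
    off the first K of them ([sorted_point_feasible],
    [sorted_point_cut]). It obeys the
    rule at every level t that separates the first K sorted entries from the
    others. The level t = [u]_K always does, which gives the characterization
    with ties. If [u]_K < [u]_(K+1), the midpoint of the two values also does; no
    entry of u lies there, so that the rule has no exception; it determines the
    solution and agrees with the rule at [u]_(K+1) ([sorted_pointE]). *)

(** The rule is not imposed at entries equal to [t]: exchanging the values
    of [g] at two of them does not change the cost, and the cardinality constraint
    may force both 0 and 1 to occur among them. *)
Definition cut (R : realType) (m : nat) (u : 'cV[R]_m) (t : R) (g : 'cV[R]_m) :
    Prop :=
  forall i, u i 0 != t -> g i 0 = threshold u t i.

(** The shift [t] is free because feasible points have equal coordinate sums. *)
Lemma feasible_cost_gap (R : realType) (m K : nat) (u g g' : 'cV[R]_m) (t : R) :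
  feasible K g -> feasible K g' ->
  sqnorm2 (g' - u) - sqnorm2 (g - u) =
  2 * \sum_(i < m) (g i 0 - g' i 0) * (u i 0 - t).
Proof.
move=> [bg sg] [bg' sg'].
have sum0 : \sum_(i < m) (g' i 0 - g i 0) * (1 - 2 * t) = 0.
  by rewrite -mulr_suml sumrB sg sg' subrr mul0r.
rewrite /sqnorm2 -sumrB mulr_sumr -[RHS]addr0 -[X in _ = _ + X]sum0 -big_split /=.
apply: eq_bigr => i _; rewrite !mxE.
by case: (bg i) (bg' i) => -> [] ->; ring.
Qed.

(** Where [u] exceeds [t], [g] takes the larger of the two values; below [t], the
    smaller. So the two factors never have opposite signs. *)
Lemma cut_gap_term_ge0 (R : realType) (m K : nat) (u g g' : 'cV[R]_m) (t : R)
    (i : 'I_m) :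
  feasible K g' -> cut u t g -> 0 <= (g i 0 - g' i 0) * (u i 0 - t).
Proof.
move=> [bg' _] cg; have [->|ut] := eqVneq (u i 0) t; first by rewrite subrr mulr0.
rewrite (cg i ut) /threshold; case: (leP t) => tu; case: (bg' i) => ->; nra.
Qed.

(** The point [g0] is a certificate: a solution cannot cost more than [g0], so
    all the nonnegative terms of the gap between them vanish. *)
Lemma is_solution_cutP (R : realType) (m K : nat) (a : R) (u g0 : 'cV[R]_m)
    (t : R) :
  0 < a -> feasible K g0 -> cut u t g0 ->
  forall g, is_solution K a u g <-> feasible K g /\ cut u t g.
Proof.
move=> a0 fg0 cg0 g; have a20 : 0 < a / 2 by rewrite divr_gt0.
split=> [[fg opt]|[fg cg]]; last first.
  split=> // g' fg'; rewrite ler_pM2l// -subr_ge0 (feasible_cost_gap u t fg fg').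
  by rewrite mulr_ge0// sumr_ge0// => i _; exact: cut_gap_term_ge0 fg' cg.
split=> // i ut.
have term_ge0 j (_ : true) : 0 <= (g0 j 0 - g j 0) * (u j 0 - t).
  exact: cut_gap_term_ge0 fg cg0.
have sum_eq0 : \sum_(j < m) (g0 j 0 - g j 0) * (u j 0 - t) = 0.
  apply/le_anti; rewrite sumr_ge0// andbT.
  have := opt _ fg0; rewrite ler_pM2l// -subr_le0.
  by rewrite (feasible_cost_gap u t fg0 fg) pmulr_rle0.
move/(psumr_eq0P term_ge0): sum_eq0 => /(_ i isT)/eqP.
by rewrite mulf_eq0 !subr_eq0 (negPf ut) orbF => /eqP <-; exact: cg0.
Qed.

Definition sorted_indices (R : realType) (m : nat) (u : 'cV[R]_m) : seq 'I_m :=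
  sort (relpre (fun i => u i 0) <=%R) (enum 'I_m).

Definition sorted_point (R : realType) (m : nat) (u : 'cV[R]_m) (K : nat) :
    'cV[R]_m :=
  \col_i (i \notin take K (sorted_indices u))%:R.

Lemma size_sorted_indices (R : realType) (m : nat) (u : 'cV[R]_m) :
  size (sorted_indices u) = m.
Proof. by rewrite size_sort size_enum_ord. Qed.

Lemma mem_sorted_indices (R : realType) (m : nat) (u : 'cV[R]_m) (i : 'I_m) :
  i \in sorted_indices u.
Proof. by rewrite mem_sort mem_enum. Qed.

Lemma kth_smallest_nth (R : realType) (m k : nat) (u : 'cV[R]_m) (i0 : 'I_m) :
  (0 < k <= m)%N -> kth_smallest u k = u (nth i0 (sorted_indices u) k.-1) 0.
Proof.
case: k => // k /= km; rewrite /kth_smallest sort_map (nth_map i0)//.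
by rewrite size_sorted_indices.
Qed.

Lemma nth_sorted_indices_le (R : realType) (m : nat) (u : 'cV[R]_m) (i0 : 'I_m)
    (j k : nat) : (j <= k < m)%N ->
  u (nth i0 (sorted_indices u) j) 0 <= u (nth i0 (sorted_indices u) k) 0.
Proof.
move=> /andP[jk km].
have le_tr : transitive (relpre (fun i : 'I_m => u i 0) <=%R).
  by move=> y x z; exact: le_trans.
have le_refl : reflexive (relpre (fun i : 'I_m => u i 0) <=%R).
  by move=> x; exact: lexx.
have le_tot : total (relpre (fun i : 'I_m => u i 0) <=%R).
  by move=> x y; exact: le_total.
apply: (sorted_leq_nth le_tr le_refl i0 (sort_sorted le_tot _)) => //.
  by rewrite inE size_sorted_indices (leq_ltn_trans jk).
by rewrite inE size_sorted_indices.
Qed.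

Lemma take_sorted_indices_le (R : realType) (m K : nat) (u : 'cV[R]_m)
    (i : 'I_m) :
  (0 < K <= m)%N -> i \in take K (sorted_indices u) -> u i 0 <= kth_smallest u K.
Proof.
move=> hK; rewrite in_take ?mem_sorted_indices// => iK.
rewrite (kth_smallest_nth u i hK) -{1}(nth_index i (mem_sorted_indices u i)).
by apply: nth_sorted_indices_le; case: K hK iK => //= K km; rewrite ltnS => ->.
Qed.

Lemma drop_sorted_indices_ge (R : realType) (m K k : nat) (u : 'cV[R]_m)
    (i : 'I_m) :
  (0 < k <= K.+1)%N -> i \notin take K (sorted_indices u) ->
  kth_smallest u k <= u i 0.
Proof.
move=> /andP[k0 kK]; rewrite in_take ?mem_sorted_indices// -leqNgt => Ki.
have im : (index i (sorted_indices u) < m)%N.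
  by rewrite -[X in (_ < X)%N](size_sorted_indices u) index_mem mem_sorted_indices.
have km : (k <= m)%N by rewrite (leq_trans kK)// (leq_ltn_trans Ki).
rewrite (kth_smallest_nth u i) ?k0//.
rewrite -{2}(nth_index i (mem_sorted_indices u i)).
apply: nth_sorted_indices_le; rewrite im andbT (leq_trans _ Ki)//.
by case: k k0 kK {km}.
Qed.

Lemma sorted_point_feasible (R : realType) (m K : nat) (u : 'cV[R]_m) :
  (K <= m)%N -> feasible K (sorted_point u K).
Proof.
move=> Km; split=> [i|]; first by rewrite mxE; case: (_ \notin _); [right|left].
have uniq_take : uniq (take K (sorted_indices u)).
  by rewrite take_uniq// sort_uniq enum_uniq.
have card_take : #|[pred i | i \in take K (sorted_indices u)]| = K.
  by rewrite (card_uniqP uniq_take) size_takel// size_sorted_indices.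
under eq_bigr do rewrite mxE.
rewrite -natr_sum -natrB//; congr (_%:R).
rewrite -[RHS](congr2 subn (card_ord m) card_take).
rewrite -(cardC [pred i | i \in take K (sorted_indices u)]) addKn -sum1_card.
by rewrite [RHS]big_mkcond /=; apply: eq_bigr => i _; rewrite !inE; case: (_ \notin _).
Qed.

(** Any level between the two groups of sorted entries works, because the rule
    is silent at entries equal to the level. *)
Lemma sorted_point_cut (R : realType) (m K : nat) (u : 'cV[R]_m) (t : R) :
  (forall i, i \in take K (sorted_indices u) -> u i 0 <= t) ->
  (forall i, i \notin take K (sorted_indices u) -> t <= u i 0) ->
  cut u t (sorted_point u K).
Proof.
move=> lo hi i ut; rewrite mxE /threshold.
have [/lo|/hi] := boolP (i \in _); last by move=> ->.
by rewrite le_eqVlt (negPf ut) /= => /lt_geF ->.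
Qed.

(** If the levels [K] and [K.+1] differ, no entry lies strictly between them, so
    the threshold at the upper one switches off exactly the first [K] sorted
    indices. *)
Lemma sorted_pointE (R : realType) (m K : nat) (u : 'cV[R]_m) (i : 'I_m) :
  (0 < K <= m)%N -> kth_smallest u K < kth_smallest u K.+1 ->
  sorted_point u K i 0 = threshold u (kth_smallest u K.+1) i.
Proof.
move=> hK gap; rewrite mxE /threshold; have [ilo|ihi] := boolP (i \in _).
  by rewrite (lt_geF (le_lt_trans (take_sorted_indices_le hK ilo) gap)).
by rewrite (drop_sorted_indices_ge _ ihi)// ltnSn.
Qed.

Theorem lemma1 (R : realType) (nd ng m K : nat)
    (src dst : 'I_m -> 'I_(nd + ng)) (d : 'cV[R]_m) (P : 'cV[R]_(nd + ng))
    (rho a : R) (gamk : 'cV[R]_m) (zk thetak : 'cV[R]_(nd + ng))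
    (u : 'cV[R]_m)
    (hnet : forall l, src l != dst l)
    (hrho : 0 < rho) (ha : 0 < a)
    (hK : (0 < K <= m)%N)
    (hu : u = prox_point src dst d P rho a gamk zk thetak) :
  (* every u: the solutions are the feasible points obeying the threshold rule
     at every entry different from the K-th smallest one *)
  (forall gam : 'cV[R]_m,
     is_solution K a u gam <->
     feasible K gam /\
     forall i, u i 0 != kth_smallest u K ->
       gam i 0 = threshold u (kth_smallest u K) i)
  /\
  (* no tie at the cut: the threshold rule, with K entries below the threshold,
     gives the unique solution *)
  ((K < m)%N -> kth_smallest u K < kth_smallest u K.+1 ->
   forall gam : 'cV[R]_m,
     is_solution K a u gam <->
     forall i, gam i 0 = threshold u (kth_smallest u K.+1) i).
Proof.
have Km : (K <= m)%N by case/andP: hK.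
have feas := sorted_point_feasible u Km.
split.
  apply: is_solution_cutP (ha) (feas) _.
  apply: sorted_point_cut => i; first exact: take_sorted_indices_le.
  by apply: drop_sorted_indices_ge; rewrite leqnSn andbT; case/andP: hK.
move=> _ gap gam; set mid := (kth_smallest u K + kth_smallest u K.+1) / 2.
have lo i : i \in take K (sorted_indices u) -> u i 0 < mid.
  by move/(take_sorted_indices_le hK); rewrite /mid; lra.
have hi i : i \notin take K (sorted_indices u) -> mid < u i 0.
  by move/(drop_sorted_indices_ge (k := K.+1) (leqnn _)); rewrite /mid; lra.
have cut_mid : cut u mid (sorted_point u K).
  by apply: sorted_point_cut => i => [/lo|/hi]; exact: ltW.
have mid_free i : u i 0 != mid.
  by have [/lo/lt_eqF|/hi/gt_eqF] := boolP (i \in take K (sorted_indices u)) => ->.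
split=> [/(is_solution_cutP ha feas cut_mid)[_ cg] i|thr].
  by rewrite -sorted_pointE// cg// cut_mid.
have -> : gam = sorted_point u K.
  by apply/colP => i; rewrite thr sorted_pointE.
by apply/(is_solution_cutP ha feas cut_mid).
Qed.
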